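(* For every integer $n\ge 1$, the projection constant of $\operatorname{Lip}_0(\mathcal{L}_n)$ satisfies $$\frac{3n-5}{8}\le \lambda(\operatorname{Lip}_0(\mathcal{L}_n))\le \frac{n+3}{2},$$ where $\mathcal{L}_n$ is the $n$-th Laakso graph.
   Context: Laakso graphs: $\mathcal{L}_0$ is the graph with two vertices joined by one edge. $\mathcal{L}_1$ is the graph with vertices $b,u,p,q,v,t$ and six edges $bu, up, pv, uq, qv, vt$; its two vertices of degree 1 are $b$ (bottom) and $t$ (top). For $n\ge1$, $\mathcal{L}_n$ is obtained from $\mathcal{L}_{n-1}$ by replacing each edge $xy$ by a copy of $\mathcal{L}_1$, identifying $x$ and $y$ with the two degree-1 vertices $b$ and $t$ of that copy. The vertex set of $\mathcal{L}_n$ is given the (unweighted) shortest path metric. For a metric space $X$ with a base point $O$, $\operatorname{Lip}_0(X)$ is the Banach space of Lipschitz functions $f:X\to\mathbb{R}$ with $f(O)=0$, normed by the Lipschitz constant of $f$ (up to isometry it does not depend on $O$). Projection constant: for a finite-dimensional normed space $X$, let $X_1$ be any subspace of $\ell_\infty$ isometrically isomorphic to $X$; then $\lambda(X)=\inf\{\|P\| : P:\ell_\infty\to\ell_\infty \text{ is a (bounded linear) projection with range } X_1\}$, which does not depend on the choice of $X_1$. *)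

(* Defs.v *)
From HB Require Import structures.
From mathcomp Require Import all_boot all_order all_algebra.
From mathcomp Require Import boolp classical_sets functions reals ereal.
From mathcomp Require Import topology normedtype.

Set Implicit Arguments.
Unset Strict Implicit.
Unset Printing Implicit Defensive.

Import Order.TTheory GRing.Theory Num.Theory.
Import numFieldNormedType.Exports.

Local Open Scope classical_set_scope.
Local Open Scope ring_scope.

(* The order of the two ends of an edge is only used to say how a copy of
   another graph is glued in its place; adjacency ignores it. *)
Record graph := Graph {
  vert : finType;
  edge : finType;
  ends : edge -> vert * vert }.

Section ShortestPath.
Variable G : graph.
Implicit Types (x y z : vert G) (k : nat).

Definition adj : rel (vert G) := fun x y =>
  [exists e : edge G, (ends e == (x, y)) || (ends e == (y, x))].

Definition walk k x y : bool :=
  [exists p : k.-tuple (vert G), path adj x p && (last x p == y)].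

(* A shortest walk has fewer than #|V| edges, so the search is exhaustive;
   the value #|V| is returned exactly when x and y are not connected. *)
Definition gdist x y : nat := find (walk^~ x ^~ y) (iota 0 #|vert G|).

Lemma walkP k x y :
  reflect (exists p, [/\ size p = k, path adj x p & last x p = y]) (walk k x y).
Proof.
apply: (iffP existsP) => [[p /andP[pp /eqP pl]]|[p [sp pp pl]]].
  by exists p; rewrite size_tuple.
have sp' : size p == k by apply/eqP.
by exists (Tuple sp'); rewrite /= pp pl eqxx.
Qed.

Lemma adj_sym x y : adj x y = adj y x.
Proof. by apply: eq_existsb => e; rewrite orbC. Qed.

Lemma walk_sym k x y : walk k x y = walk k y x.
Proof.
suff W a b : walk k a b -> walk k b a by apply/idP/idP; exact: W.
move=> /walkP[p [sp pp pl]]; apply/walkP; exists (rev (belast a p)).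
split; first by rewrite size_rev size_belast.
- by rewrite -pl rev_path (eq_path (e' := adj))// => u v; rewrite adj_sym.
- by case: p pl {sp pp} => [<-//|c p _]; rewrite /= rev_cons last_rcons.
Qed.

Lemma walk_cat k l x y z : walk k x y -> walk l y z -> walk (k + l) x z.
Proof.
move=> /walkP[p [sp pp pl]] /walkP[q [sq pq ql]].
apply/walkP; exists (p ++ q).
by rewrite size_cat sp sq cat_path pp last_cat pl.
Qed.

Lemma gdist_max x y : (gdist x y <= #|vert G|)%N.
Proof. by rewrite -[leqRHS](size_iota 0); apply: find_size. Qed.

Lemma gdist_le k x y : walk k x y -> (gdist x y <= k)%N.
Proof.
move=> w; rewrite leqNgt; apply/negP => lt_k.
have := before_find 0%N lt_k.
by rewrite nth_iota ?add0n ?w// (leq_trans lt_k (gdist_max _ _)).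
Qed.

Lemma walk_gdist x y : (gdist x y < #|vert G|)%N -> walk (gdist x y) x y.
Proof.
move=> lt_d; have hasw : has (walk^~ x ^~ y) (iota 0 #|vert G|).
  by rewrite has_find size_iota.
by have := nth_find 0%N hasw; rewrite nth_iota// add0n.
Qed.

Lemma gdist_lt x y : connect adj x y = (gdist x y < #|vert G|)%N.
Proof.
apply/idP/idP => [/connectP[p pp ->]|/walk_gdist/walkP[p [_ pp <-]]]; last first.
  by apply/connectP; exists p.
case/shortenP: pp => p' pp' up' _.
have /gdist_le : walk (size p') x (last x p') by apply/walkP; exists p'.
move/leq_ltn_trans; apply.
by have := max_card (mem (x :: p')); rewrite (card_uniqP up').
Qed.

Lemma gdistxx x : gdist x x = 0%N.
Proof.
by apply/eqP; rewrite -leqn0; apply: gdist_le; apply/walkP; exists [::].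
Qed.

Lemma gdist_eq0 x y : gdist x y = 0%N -> x = y.
Proof.
move=> d0; have /walk_gdist : (gdist x y < #|vert G|)%N.
  by rewrite d0; apply/card_gt0P; exists x.
by rewrite d0 => /walkP[p [/size0nil-> _ /= ->]].
Qed.

Lemma gdist_sym x y : gdist x y = gdist y x.
Proof. by rewrite /gdist; apply: eq_find => k; rewrite /= walk_sym. Qed.

Lemma gdist_triangle y x z : (gdist x z <= gdist x y + gdist y z)%N.
Proof.
have [/walk_gdist xy|xy] := ltnP (gdist x y) #|vert G|; last first.
  by rewrite (leq_trans (gdist_max _ _))// (leq_trans xy)// leq_addr.
have [/walk_gdist yz|yz] := ltnP (gdist y z) #|vert G|; last first.
  by rewrite (leq_trans (gdist_max _ _))// (leq_trans yz)// leq_addl.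
exact/gdist_le/(walk_cat xy).
Qed.

End ShortestPath.

Definition graph_space (R : realType) (G : graph) : Type := vert G.

Section GraphSpace.
Variables (R : realType) (G : graph).

HB.instance Definition _ := Finite.on (graph_space R G).

Let d (x y : graph_space R G) : R := (@gdist G x y)%:R.

Let dxx x : d x x = 0. Proof. by rewrite /d gdistxx. Qed.

Let d_positivity x y : d x y = 0 -> x = y.
Proof. by move/eqP; rewrite pnatr_eq0 => /eqP/gdist_eq0. Qed.

Let d_sym x y : d x y = d y x. Proof. by rewrite /d gdist_sym. Qed.

Let d_triangle y x z : d x z <= d x y + d y z.
Proof. by rewrite /d -natrD ler_nat gdist_triangle. Qed.

HB.instance Definition _ := @isMetric.Build R (graph_space R G)
  d dxx d_positivity d_sym d_triangle.

End GraphSpace.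

(* The vertices of L_1 other than its two vertices of degree 1. *)
Inductive inner := Iu | Ip | Iq | Iv.

Definition inner_ord (i : inner) : 'I_4 :=
  match i with
  | Iu => inord 0 | Ip => inord 1 | Iq => inord 2 | Iv => inord 3
  end.

Definition ord_inner (i : 'I_4) : inner := nth Iu [:: Iu; Ip; Iq; Iv] i.

Lemma inner_ordK : cancel inner_ord ord_inner.
Proof. by case; rewrite /ord_inner /= inordK. Qed.

HB.instance Definition _ := Finite.copy inner (can_type inner_ordK).

Inductive laakso1_vertex := Bottom | Top | Inner of inner.

Definition laakso1_edge : 6.-tuple (laakso1_vertex * laakso1_vertex) :=
  let: (b, t, u, p, q, v) :=
    (Bottom, Top, Inner Iu, Inner Ip, Inner Iq, Inner Iv) in
  [tuple (b, u); (u, p); (p, v); (u, q); (q, v); (v, t)].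

(* Every edge e of G is replaced by a copy of L_1, whose four inner vertices
   are the inr (e, _); its bottom and top are the two ends of e.  The
   orientation of e is immaterial, as L_1 has an automorphism exchanging its
   bottom and its top. *)
Section Replace.
Variable G : graph.

Definition glue (e : edge G) (w : laakso1_vertex) :
    vert G + edge G * inner :=
  match w with
  | Bottom => inl (ends e).1
  | Top => inl (ends e).2
  | Inner i => inr (e, i)
  end.

Definition replace_edges : graph :=
  @Graph (vert G + edge G * inner)%type (edge G * 'I_6)%type
    (fun ei => let: (x, y) := tnth laakso1_edge ei.2 in
               (glue ei.1 x, glue ei.1 y)).

End Replace.

Definition laakso0 : graph := @Graph bool unit (fun=> (false, true)).

Definition laakso (n : nat) : graph := iter n replace_edges laakso0.

Section Connected.

Let adj1 (G : graph) (e : edge G) (i : 'I_6) (x y : laakso1_vertex) :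
  tnth laakso1_edge i = (x, y) ->
  @adj (replace_edges G) (glue e x) (glue e y).
Proof. by move=> xy; apply/existsP; exists (e, i); rewrite /= xy eqxx. Qed.

Let connect_glue (G : graph) (e : edge G) (x y : laakso1_vertex) :
  connect (@adj (replace_edges G)) (glue e x) (glue e y).
Proof.
have sym : connect_sym (@adj (replace_edges G)).
  exact/sym_connect_sym/adj_sym.
suff fromu w : connect (@adj (replace_edges G)) (glue e (Inner Iu)) (glue e w).
  by apply: connect_trans (fromu y); rewrite sym.
have c (i : nat) x' y' (lt_i : (i < 6)%N) :
    tnth laakso1_edge (Ordinal lt_i) = (x', y') ->
    connect (@adj (replace_edges G)) (glue e x') (glue e y').
  by move=> /(adj1 e)/connect1.
have up := c 1%N _ _ isT erefl; have pv := c 2%N _ _ isT erefl.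
have uv := connect_trans up pv.
case: w => [||[]]; rewrite ?connect0//.
- by rewrite sym; apply: (c 0%N _ _ isT).
- by apply: connect_trans uv _; apply: (c 5%N _ _ isT).
- exact: (c 3%N _ _ isT).
Qed.

Lemma laakso_connected n (x y : vert (laakso n)) : connect (@adj _) x y.
Proof.
have c01 : connect (@adj laakso0) false true.
  by apply: connect1; apply/existsP; exists tt.
suff [] : (forall x y : vert (laakso n), connect (@adj _) x y) /\
    (forall x : vert (laakso n), exists e w, x = if w then (@ends (laakso n) e).1
                                   else (@ends (laakso n) e).2) by [].
elim: n {x y} => [|n [IHc IHe]].
  split=> [[] []|x].
  - exact: connect0.
  - by rewrite (sym_connect_sym (@adj_sym laakso0)).
  - exact: c01.
  - exact: connect0.
  - by exists tt, (~~ x); case: x.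
have sym := sym_connect_sym (@adj_sym (laakso n.+1)).
have inlC (x y : vert (laakso n)) :
    connect (@adj (laakso n.+1)) (inl x) (inl y).
  have /connectP[p pp ->] := IHc x y; elim: p x pp => [|z p IHp] x /=.
    by rewrite connect0.
  move=> /andP[/existsP[e xz] /IHp]; apply: connect_trans.
  case/orP: xz => /eqP ez; have := connect_glue e Bottom Top; rewrite /= ez//.
  by rewrite sym.
split=> [x y|].
  have toinl (x' : vert (laakso n.+1)) : exists x0 : vert (laakso n),
      connect (@adj (laakso n.+1)) x' (inl x0).
    case: x' => [x0|[e i]]; first by exists x0; rewrite connect0.
    by exists (ends e).1; apply: (connect_glue e (Inner i) Bottom).
  have [x0 xx0] := toinl x; have [y0 yy0] := toinl y.
  apply: connect_trans xx0 _; apply: connect_trans (inlC _ y0) _.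
  by rewrite sym.
have pick (e : edge (laakso n)) (i : nat) (lt_i : (i < 6)%N) (b : bool) :
  exists (e' : edge (laakso n.+1)) w,
  glue e (let t := tnth laakso1_edge (Ordinal lt_i) in if b then t.1 else t.2)
   = if w then (@ends (laakso n.+1) e').1 else (@ends (laakso n.+1) e').2.
  by exists (e, Ordinal lt_i), b; case: b => /=; case: (tnth _ _).
case=> [x|[e i]].
  have [e [w ->]] := IHe x.
  by case: w; [exact: (pick e 0%N isT true)|exact: (pick e 5%N isT false)].
case: i; first exact: (pick e 0%N isT false).
- exact: (pick e 1%N isT false).
- exact: (pick e 3%N isT false).
- exact: (pick e 2%N isT false).
Qed.

End Connected.

Definition laakso_space (R : realType) (n : nat) : metricType R :=
  graph_space R (laakso n).

Section EllInfty.
Variable R : realType.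

Definition bounded_seq : {pred nat -> R} :=
  [pred u : nat -> R | `[< bounded_fun u >]].

Record ell_infty := EllInfty {
  ell_val :> nat -> R;
  ell_valP : ell_val \in bounded_seq }.

HB.instance Definition _ := [isSub for ell_val].
HB.instance Definition _ := [Choice of ell_infty by <:].

Lemma bounded_seqP (u : nat -> R) :
  u \in bounded_seq <-> exists M, forall n, `|u n| <= M.
Proof.
have PF : ProperFilter (globally [set: nat]).
  exact: (globally_properfilter (a := 0%N)).
split=> [/asboolP/ex_bound[M] /= uM|[M uM]]; first by exists M => n; apply: uM.
by apply/asboolP/ex_bound; exists M => n _; apply: uM.
Qed.

Lemma bounded_seq_submod_closed : submod_closed bounded_seq.
Proof.
split; first by apply/bounded_seqP; exists 0 => n; rewrite normr0.
move=> a u v /bounded_seqP[M uM] /bounded_seqP[N vN].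
apply/bounded_seqP; exists (`|a| * M + N) => n.
apply: le_trans (ler_normD _ _) _; apply: lerD; last exact: vN.
by rewrite normrM; apply: ler_wpM2l.
Qed.

HB.instance Definition _ :=
  GRing.isSubmodClosed.Build _ _ bounded_seq bounded_seq_submod_closed.
HB.instance Definition _ := [SubChoice_isSubLmodule of ell_infty by <:].

Definition ell_norm (u : ell_infty) : R := sup (range (fun n => `|u n|)).

Lemma ell_norm_ub (u : ell_infty) n : `|u n| <= ell_norm u.
Proof.
have [M uM] : exists M, forall n, `|u n| <= M by apply/bounded_seqP/ell_valP.
by apply: ub_le_sup; [exists M => _ [m _ <-]|exists n].
Qed.

Lemma ell_norm_le (u : ell_infty) M : (forall n, `|u n| <= M) -> ell_norm u <= M.
Proof.
by move=> uM; apply: ge_sup; [exists `|u 0%N|, 0%N|move=> _ [n _ <-]].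
Qed.

Let ell_normD (u v : ell_infty) : ell_norm (u + v) <= ell_norm u + ell_norm v.
Proof.
apply: ell_norm_le => n; apply: le_trans (ler_normD _ _) _.
by apply: lerD; exact: ell_norm_ub.
Qed.

Let ell_normZ (a : R) (u : ell_infty) : ell_norm (a *: u) = `|a| * ell_norm u.
Proof.
have le b v : ell_norm (b *: v) <= `|b| * ell_norm v.
  by apply: ell_norm_le => n; rewrite normrM ler_wpM2l// ell_norm_ub.
apply/eqP; rewrite eq_le le /=; have [->|a0] := eqVneq a 0.
  rewrite normr0 mul0r; exact: le_trans (ell_norm_ub _ 0%N).
by rewrite -ler_pdivlMl ?normr_gt0// -normfV -{1}[u](scalerK a0) le.
Qed.

Let ell_norm0_eq0 (u : ell_infty) : ell_norm u = 0 -> u = 0.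
Proof.
move=> u0; apply: val_inj; apply/funext => n.
by apply/eqP; rewrite -normr_le0 -u0 ell_norm_ub.
Qed.

HB.instance Definition _ := @Lmodule_isNormed.Build R ell_infty
  ell_norm ell_normD ell_normZ ell_norm0_eq0.

End EllInfty.

Section Lip0.
Variables (R : realType) (X : metricType R) (O : X).

Definition klipschitz (k : R) (f : X -> R) : Prop :=
  forall x y, `|f x - f y| <= k * mdist x y.

Definition lip_const (f : X -> R) : R :=
  inf [set k : R | 0 <= k /\ klipschitz k f].

Definition lip0_pred : {pred X -> R} :=
  [pred f : X -> R | `[< f O = 0 /\ exists k, klipschitz k f >]].

Record Lip0 := MkLip0 {
  lip_val :> X -> R;
  lip_valP : lip_val \in lip0_pred }.

HB.instance Definition _ := [isSub for lip_val].
HB.instance Definition _ := [Choice of Lip0 by <:].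

Lemma klipschitzW k l f : k <= l -> klipschitz k f -> klipschitz l f.
Proof.
by move=> kl kf x y; apply: le_trans (kf x y) _; rewrite ler_wpM2r ?mdist_ge0.
Qed.

Lemma klipschitzD k l f g :
  klipschitz k f -> klipschitz l g -> klipschitz (k + l) (f + g).
Proof.
move=> kf lg x y; rewrite mulrDl [_ - _](_ : _ = (f x - f y) + (g x - g y)).
  by apply: le_trans (ler_normD _ _) _; apply: lerD.
by rewrite opprD addrACA.
Qed.

Lemma klipschitzZ a k f : klipschitz k f -> klipschitz (`|a| * k) (a *: f).
Proof.
by move=> kf x y; rewrite -[_ - _]mulrBr normrM -mulrA ler_wpM2l.
Qed.

Lemma lip0_submod_closed : submod_closed lip0_pred.
Proof.
split.
  by apply/asboolP; split=> //; exists 0 => x y; rewrite subrr normr0 mul0r.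
move=> a f g /asboolP[f0 [k kf]] /asboolP[g0 [l lg]]; apply/asboolP; split.
  by rewrite -[LHS]/(a * f O + g O) f0 g0 mulr0 addr0.
by exists (`|a| * k + l); apply: klipschitzD => //; exact: klipschitzZ.
Qed.

HB.instance Definition _ :=
  GRing.isSubmodClosed.Build _ _ lip0_pred lip0_submod_closed.
HB.instance Definition _ := [SubChoice_isSubLmodule of Lip0 by <:].

Lemma lip_val0 (f : Lip0) : f O = 0.
Proof. by have /asboolP[] := lip_valP f. Qed.

Let lip_has_inf (f : Lip0) : has_inf [set k | 0 <= k /\ klipschitz k f].
Proof.
have /asboolP[_ [k kf]] := lip_valP f; split; last by exists 0 => ? [].
by exists `|k|; split => //; apply: klipschitzW kf; exact: ler_norm.
Qed.

Lemma lip_const_ge0 (f : Lip0) : 0 <= lip_const f.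
Proof. by apply: lb_le_inf; [have [] := lip_has_inf f|move=> ? []]. Qed.

Lemma lip_constP (f : Lip0) : klipschitz (lip_const f) f.
Proof.
move=> x y; have [->|xy] := eqVneq x y; first by rewrite subrr normr0 mdistxx mulr0.
have d0 : 0 < mdist x y by rewrite mdist_gt0.
rewrite -ler_pdivrMr//; apply: lb_le_inf; first by have [] := lip_has_inf f.
by move=> k [_ kf]; rewrite ler_pdivrMr.
Qed.

Lemma lip_const_le (f : Lip0) k : 0 <= k -> klipschitz k f -> lip_const f <= k.
Proof. by move=> k0 kf; apply: ge_inf => //; exists 0 => ? []. Qed.

Let lip_constD (f g : Lip0) : lip_const (f + g)%R <= lip_const f + lip_const g.
Proof.
apply: (@lip_const_le (f + g)); first by rewrite addr_ge0 ?lip_const_ge0.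
by apply: klipschitzD; exact: lip_constP.
Qed.

Let lip_constZ (a : R) (f : Lip0) : lip_const (a *: f)%R = `|a| * lip_const f.
Proof.
have le b (g : Lip0) : lip_const (b *: g)%R <= `|b| * lip_const g.
  apply: (@lip_const_le (b *: g)); first by rewrite mulr_ge0 ?lip_const_ge0.
  by apply: klipschitzZ; exact: lip_constP.
apply/eqP; rewrite eq_le le /=; have [->|a0] := eqVneq a 0.
  by rewrite normr0 mul0r; exact: (@lip_const_ge0 (0 *: f)).
by rewrite -ler_pdivlMl ?normr_gt0// -normfV -{1}[f](scalerK a0) le.
Qed.

Let lip_const0_eq0 (f : Lip0) : lip_const f = 0 -> f = 0.
Proof.
move=> f0; apply: val_inj; apply/funext => x.
apply/eqP; rewrite -normr_le0.
by have := lip_constP f x O; rewrite f0 lip_val0 subr0 mul0r.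
Qed.

HB.instance Definition _ := @Lmodule_isNormed.Build R Lip0
  (fun f : Lip0 => lip_const f) lip_constD lip_constZ lip_const0_eq0.

End Lip0.

Section ProjectionConstant.
Variable R : realType.

Definition isometric_copy (X : normedModType R) (X1 : set (ell_infty R)) :=
  exists J : {linear X -> ell_infty R},
    (forall x, `|J x| = `|x|) /\ range J = X1.

Definition op_norm (V W : normedModType R) (T : {linear V -> W}) : R :=
  sup [set `|T x| | x in [set x | `|x| <= 1]].

Definition projection_onto (X1 : set (ell_infty R))
    (P : {linear ell_infty R -> ell_infty R}) : Prop :=
  [/\ continuous P, P \o P =1 P & range P = X1].

(* The infimum is taken in \bar R, so that it is +oo (and not 0) for an
   uncomplemented subspace X1. *)
Definition projection_constant (X1 : set (ell_infty R)) : \bar R :=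
  ereal_inf [set (op_norm P)%:E | P in projection_onto X1].

End ProjectionConstant.

Section CopyOfLip0.
Variables (R : realType) (G : graph) (O : graph_space R G).

Let quot (f : Lip0 O) (n : nat) : R :=
  if unpickle n is Some (x, y) then (f x - f y) / mdist x y else 0.

Let quot_le f n : `|quot f n| <= `|f|.
Proof.
rewrite /quot; case: unpickle => [[x y]|]; last by rewrite normr0.
have [->|xy] := eqVneq x y; first by rewrite subrr mul0r normr0.
have d0 : 0 < mdist x y by rewrite mdist_gt0.
by rewrite normrM normfV (gtr0_norm d0) ler_pdivrMr// lip_constP.
Qed.

Let quot_bounded f : quot f \in @bounded_seq R.
Proof. by apply/bounded_seqP; exists `|f| => n; exact: quot_le. Qed.

Let J f : ell_infty R := EllInfty (quot_bounded f).

Let J_linear : linear J.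
Proof.
move=> a f g; apply: val_inj; apply/funext => n; rewrite /= /quot.
rewrite -[RHS]/(a * _ + _) /quot; case: unpickle => [[x y]|].
  rewrite mulrA -mulrDl; congr (_ / _).
  by rewrite -[LHS]/(a * f x + g x - (a * f y + g y)) mulrBr opprD addrACA.
by rewrite mulr0 addr0.
Qed.

HB.instance Definition _ := GRing.isLinear.Build R _ _ _ J J_linear.

Lemma lip0_isometric_copy : exists X1, isometric_copy (Lip0 O) X1.
Proof.
exists (range J), J; split=> // f; apply/eqP; rewrite eq_le; apply/andP; split.
  by apply: ell_norm_le => n; exact: quot_le.
apply: lip_const_le => // x y; have [->|xy] := eqVneq x y.
  by rewrite subrr normr0 mdistxx mulr0.
have d0 : 0 < mdist x y by rewrite mdist_gt0.
rewrite -ler_pdivrMr//.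
apply: le_trans (ell_norm_ub (J f) (pickle (x, y))).
by rewrite /= /quot pickleK normrM normfV (gtr0_norm d0).
Qed.

End CopyOfLip0.

(* Main.v *)
(* Edge functions on L_n that are differences of a potential ("balanced") form a
   subspace B_n of R^(E_n), and Lip_0(L_n) is isometric to B_n with the sup norm.
   By Hahn-Banach, projections of l_infty onto a copy of Lip_0(L_n) and
   projections of R^(E_n) onto B_n have the same norms.  With the symmetric unit
   flow of L_1 (1 on the two end edges, 1/2 on the four edges of the 4-cycle), an
   edge function h on L_(n+1) is balanced iff its circulation around each newest
   4-cycle vanishes and its flow-averaged rise over each copy of L_1 is balanced
   on L_n.

   Upper bound: an explicit projection [h - defect h].  The correction of h at an
   edge e is a combination of the circulations of h around the 4-cycles through
   e, one for each level; the weight of a cycle is the number of levels, counted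
   in halves, separating it from the next finer cycle through e, so that the
   total weight telescopes to at most (n+1)/2.

   Lower bound, by trace duality: there are a probability [mass] on the edges and
   functions [test e], bounded by 1, such that [sum_e mass e * Q (test e) e]
   takes the value 3n/8 at every projection Q onto B_n.  Passing from n to n+1
   replaces Q by [rise \o Q \o spread] and adds the contribution 3/8 of the
   newest 4-cycles. *)
From HB Require Import structures.
Require Import Defs.
From mathcomp Require Import all_boot all_order all_algebra.
From mathcomp Require Import boolp classical_sets functions reals ereal.
From mathcomp Require Import topology normedtype.
From mathcomp Require Import ring lra.

Set Implicit Arguments.
Unset Strict Implicit.
Unset Printing Implicit Defensive.

Import Order.TTheory GRing.Theory Num.Theory.
Import numFieldNormedType.Exports.

Local Open Scope classical_set_scope.
Local Open Scope ring_scope.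

(** * The Hahn-Banach theorem *)

Section HahnBanach.
Variables (R : realType) (V : lmodType R) (p : V -> R).
Hypothesis p_subadd : forall x y, p (x + y) <= p x + p y.
Hypothesis p_homo : forall a x, 0 <= a -> p (a *: x) = a * p x.

(* A partial linear functional is handled through its graph; domination by [p]
   makes a linear relation single-valued. *)
Let dominated (G : set (V * R)) :=
  (forall a u v, G u -> G v -> G (a *: u.1 + v.1, a * u.2 + v.2)) /\
  (forall u, G u -> u.2 <= p u.1).

Let dominated_fun (G : set (V * R)) x r s :
  dominated G -> G (x, r) -> G (x, s) -> r = s.
Proof.
move=> [Glin Gle]; have p0 : p 0 = 0 by rewrite -(scale0r 0) p_homo// mul0r.
suff le t u : G (x, t) -> G (x, u) -> u <= t.
  by move=> Gr Gs; apply/eqP; rewrite eq_le !le.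
move=> Gt Gu; have := Gle _ (Glin (-1) _ _ Gt Gu).
by rewrite /= scaleN1r addNr p0; lra.
Qed.

Let extend (G : set (V * R)) (v : V) (c : R) : set (V * R) :=
  [set u | exists x r a, G (x, r) /\ u = (x + a *: v, r + a * c)].

(** The value [c] at [v] must lie above all [u.2 - p (u.1 - v)] and below all [p (w.1 + v) - w.2];
    subadditivity separates the two families, and homogeneity reduces multiples of [v] to [v] and
    [- v]. *)
Let dominated_extend (G : set (V * R)) (v : V) :
  G !=set0 -> dominated G -> exists c, dominated (extend G v c).
Proof.
move=> [[x0 r0] G0] [Glin Gle].
pose L := [set u.2 - p (u.1 - v) | u in G].
have LU u w : G u -> G w -> u.2 - p (u.1 - v) <= p (w.1 + v) - w.2.
  move=> Gu Gw; have := Gle _ (Glin 1 _ _ Gu Gw); rewrite /= scale1r mul1r.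
  have := p_subadd (u.1 - v) (w.1 + v).
  by rewrite [_ - v + _]addrACA addNr addr0; lra.
have supL : has_sup L.
  split; first by exists (r0 - p (x0 - v)), (x0, r0).
  by exists (p (x0 + v) - r0) => _ [u Gu <-]; exact: (LU u (x0, r0)).
have lec u : G u -> u.2 - p (u.1 - v) <= sup L.
  by move=> Gu; apply: ub_le_sup; [case: supL|exists u].
have cle u : G u -> sup L <= p (u.1 + v) - u.2.
  by move=> Gu; apply: ge_sup; [case: supL|move=> _ [w Gw <-]; exact: LU].
have Gz : G (0, 0).
  by have := Glin (-1) _ _ G0 G0; rewrite /= scaleN1r mulN1r !addNr.
have GZ a x r : G (x, r) -> G (a *: x, a * r).
  by move=> Gx; have := Glin a _ _ Gx Gz; rewrite /= !addr0.
exists (sup L); split=> [a _ _ [x [r [b [Gx ->]]]] [y [s [d [Gy ->]]]]|].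
  exists (a *: x + y), (a * r + s), (a * b + d); split; first exact: (Glin a _ _ Gx Gy).
  by congr (_, _) => /=; [rewrite scalerDr scalerDl scalerA addrACA|ring].
move=> _ [x [r [a [Gx ->]]]] /=; have [a0|a0|->] := ltgtP a 0.
- have b0 : 0 < - a by rewrite oppr_gt0.
  have := lec _ (GZ (- a)^-1 x r Gx); rewrite /=.
  rewrite -(ler_pM2l b0) mulrBr mulrA mulfV ?gt_eqF// mul1r.
  rewrite -(p_homo _ (ltW b0)) scalerBr scalerA mulfV ?gt_eqF// scale1r scaleNr opprK.
  by lra.
- have := cle _ (GZ a^-1 x r Gx); rewrite /=.
  rewrite -(ler_pM2l a0) mulrBr mulrA mulfV ?gt_eqF// mul1r.
  rewrite -(p_homo _ (ltW a0)) scalerDr scalerA mulfV ?gt_eqF// scale1r.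
  by lra.
- by rewrite scale0r mul0r !addr0; exact: (Gle _ Gx).
Qed.

Theorem hahn_banach (U : lmodType R) (S : {linear U -> V}) (g : {scalar U}) :
  (forall x, g x <= p (S x)) ->
  exists f : {scalar V}, (forall x, f (S x) = g x) /\ forall y, f y <= p y.
Proof.
move=> gp; pose G0 : set (V * R) := [set (S x, g x) | x in [set: U]].
have domG0 : dominated G0.
  split=> [a _ _ [x _ <-] [y _ <-]|_ [x _ <-]]; last exact: gp.
  by exists (a *: x + y); rewrite ?linearP.
(* Joining [G0] inside the predicate makes it hold for the union of the empty chain. *)
have [|A [domA maxA]] := @Zorn_bigcup _ [set A | dominated (A `|` G0)].
  move=> F FP Ftot; have FG (X : set (V * R)) u : F X -> (X `|` G0) u ->
      (\bigcup_(X in F) X `|` G0) u by move=> FX [Xu|]; [left; exists X|right].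
  split=> [a u v|u [[X FX Xu]|G0u]]; last exact: domG0.2.
    move=> [[X FX Xu]|Gu] [[Y FY Yv]|Gv].
    - have [XY|YX] := Ftot _ _ FX FY.
        by apply: (FG Y) => //; apply: (FP _ FY).1; left=> //; exact: XY.
      by apply: (FG X) => //; apply: (FP _ FX).1; left=> //; exact: YX.
    - by apply: (FG X) => //; apply: (FP _ FX).1; [left|right].
    - by apply: (FG Y) => //; apply: (FP _ FY).1; [right|left].
    - by right; exact: domG0.1.
  by apply: (FP _ FX).2; left.
have [Glin Gle] := domA.
have Gtot v : exists r, (A `|` G0) (v, r).
  have Gz : (A `|` G0) (0, 0) by right; exists 0; rewrite ?linear0.
  have [c domc] := @dominated_extend (A `|` G0) v (ex_intro _ _ Gz) domA.
  have sub : A `|` G0 `<=` extend (A `|` G0) v c.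
    by move=> [x r] Gx; exists x, r, 0; rewrite scale0r mul0r !addr0.
  have extv : extend (A `|` G0) v c (v, c).
    by exists 0, 0, 1; rewrite scale1r mul1r !add0r.
  apply: contrapT => nv; apply: (maxA (extend (A `|` G0) v c)); last first.
    by rewrite /= setUidl// => u Gu; apply: sub; right.
  split; first by move=> u Au; apply: sub; left.
  by move=> /(_ _ extv) Av; apply: nv; exists c; left.
have [f fG] := choice Gtot.
have f_scalar : scalar f.
  move=> a x y; apply: dominated_fun domA (fG _) _.
  exact: (Glin a _ _ (fG x) (fG y)).
pose fS : {scalar V} := HB.pack f (GRing.isLinear.Build _ _ _ _ f f_scalar).
exists fS; split=> [x|y]; last exact: (Gle _ (fG y)).
by apply: dominated_fun domA (fG _) _; right; exists x.
Qed.

End HahnBanach.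

Lemma scalar_norm_le (R : realType) (V : lmodType R) (f : {scalar V})
    (p : V -> R) x :
  (forall y, p (- y) = p y) -> (forall y, f y <= p y) -> `|f x| <= p x.
Proof.
move=> pN fp; rewrite ler_norml fp andbT.
by have := fp (- x); rewrite linearN pN lerNl.
Qed.

(** * Projections onto balanced edge functions *)

Lemma lincombE (T : Type) (R : realType) (a : R) (g h : T -> R) x :
  (a *: g + h) x = a * g x + h x.
Proof. by []. Qed.

Lemma subfunE (T : Type) (R : realType) (g h : T -> R) x :
  (g - h) x = g x - h x.
Proof. by []. Qed.

Notation ord6 k := (@Ordinal 6 k isT).

Lemma sum_ord6 (V : nmodType) (F : 'I_6 -> V) :
  \sum_i F i = F (ord6 0) + F (ord6 1) + F (ord6 2) + F (ord6 3)
             + F (ord6 4) + F (ord6 5).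
Proof.
rewrite !big_ord_recr big_ord0 /= add0r.
by do ![congr (_ + _)]; congr F; apply: val_inj.
Qed.

Lemma ord6_ind (P : 'I_6 -> Prop) :
  P (ord6 0) -> P (ord6 1) -> P (ord6 2) -> P (ord6 3) -> P (ord6 4) ->
  P (ord6 5) -> forall i, P i.
Proof.
move=> P0 P1 P2 P3 P4 P5 [[|[|[|[|[|[|//]]]]]] lt_i];
by rewrite (bool_irrelevance lt_i isT).
Qed.

Section EdgeFunctions.
Variable R : realType.

(* The symmetric unit flow from bottom to top of [L_1], and the circulation
   around its 4-cycle; both list the edges in the order of [laakso1_edge]. *)
Definition flow (i : 'I_6) : R := nth 0 [:: 1; 2^-1; 2^-1; 2^-1; 2^-1; 1] i.
Definition circ (i : 'I_6) : R := nth 0 [:: 0; 1; 1; -1; -1; 0] i.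

Section OneStep.
Variable E : Type.
Implicit Types (h : E * 'I_6 -> R) (e : E).

Definition rise h e : R := \sum_i flow i * h (e, i).
Definition curl h e : R := \sum_i circ i * h (e, i).
(** Linear interpolation: a path from bottom to top of [L_1] has 4 edges. *)
Definition spread (h : E -> R) (ei : E * 'I_6) : R := h ei.1 / 4.

Lemma riseE h e : rise h e = h (e, ord6 0) + (h (e, ord6 1) + h (e, ord6 2)
  + h (e, ord6 3) + h (e, ord6 4)) / 2 + h (e, ord6 5).
Proof. by rewrite /rise sum_ord6 /flow /=; field. Qed.

Lemma curlE h e : curl h e = h (e, ord6 1) + h (e, ord6 2)
  - h (e, ord6 3) - h (e, ord6 4).
Proof. by rewrite /curl sum_ord6 /circ /=; ring. Qed.

Lemma rise_linear : linear rise.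
Proof. by move=> a g h; apply/funext => e; rewrite lincombE !riseE !lincombE; ring. Qed.

Lemma curl_linear : linear curl.
Proof. by move=> a g h; apply/funext => e; rewrite lincombE !curlE !lincombE; ring. Qed.

Lemma spread_linear : linear spread.
Proof. by move=> a g h; apply/funext => e; rewrite lincombE /spread !lincombE; ring. Qed.

HB.instance Definition _ := GRing.isLinear.Build R _ _ _ rise rise_linear.
HB.instance Definition _ := GRing.isLinear.Build R _ _ _ curl curl_linear.
HB.instance Definition _ := GRing.isLinear.Build R _ _ _ spread spread_linear.

Lemma rise_spread (h : E -> R) : rise (spread h) = h.
Proof. by apply/funext => e; rewrite riseE /spread /=; field. Qed.

Lemma curl_spread (h : E -> R) : curl (spread h) = 0.
Proof. by apply/funext => e; rewrite -[RHS]/(0 : R) curlE /spread /=; ring. Qed.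

(** The weights in [flow] are nonnegative with sum 4. *)
Lemma rise_le h (M : R) : (forall ei, `|h ei| <= M) -> forall e, `|rise h e / 4| <= M.
Proof.
move=> hM e.
have hi i : - M <= h (e, i) <= M by rewrite -ler_norml.
have /andP[? ?] := hi (ord6 0).
have /andP[? ?] := hi (ord6 1).
have /andP[? ?] := hi (ord6 2).
have /andP[? ?] := hi (ord6 3).
have /andP[? ?] := hi (ord6 4).
have /andP[? ?] := hi (ord6 5).
rewrite ler_norml riseE; apply/andP; split; lra.
Qed.

Lemma curl_le h (M : R) : (forall ei, `|h ei| <= M) -> forall e, `|curl h e / 4| <= M.
Proof.
move=> hM e.
have hi i : - M <= h (e, i) <= M by rewrite -ler_norml.
have /andP[? ?] := hi (ord6 1).
have /andP[? ?] := hi (ord6 2).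
have /andP[? ?] := hi (ord6 3).
have /andP[? ?] := hi (ord6 4).
rewrite ler_norml curlE; apply/andP; split; lra.
Qed.

End OneStep.

(** * Balanced functions and the explicit projection *)

Fixpoint balanced n : (edge (laakso n) -> R) -> Prop :=
  match n with
  | 0 => fun=> True
  | m.+1 => fun h : edge (laakso m) * 'I_6 -> R =>
      curl h = 0 /\ @balanced m (rise h)
  end.

(* Up to sign, the mean of [h] around the newest 4-cycle that contains [e] (in
   the copy of [L_m] replacing one of its edges), or 0 if there is none. *)
Fixpoint last_curl n : (edge (laakso n) -> R) -> edge (laakso n) -> R :=
  match n return (edge (laakso n) -> R) -> edge (laakso n) -> R with
  | 0 => fun=> 0
  | m.+1 => fun (h : edge (laakso m) * 'I_6 -> R) ei =>
      (circ ei.2 * curl h ei.1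
       + (1 - circ ei.2 ^+ 2) * @last_curl m (rise h) ei.1) / 4
  end.

(* When a level is added, the newest 4-cycle through [e] gains or loses half a
   unit of weight, according to whether [e] is an end edge or a cycle edge of its
   copy of [L_1]. *)
Fixpoint defect n : (edge (laakso n) -> R) -> edge (laakso n) -> R :=
  match n return (edge (laakso n) -> R) -> edge (laakso n) -> R with
  | 0 => fun=> 0
  | m.+1 => fun (h : edge (laakso m) * 'I_6 -> R) ei =>
      (circ ei.2 * curl h ei.1 + @defect m (rise h) ei.1
       + (2^-1 - circ ei.2 ^+ 2) * @last_curl m (rise h) ei.1) / 4
  end.

Lemma last_curl_linear n : linear (@last_curl n).
Proof.
elim: n => [|n IHn] a g h; apply/funext => e; rewrite lincombE /=.
  by rewrite mulr0 addr0.
by rewrite rise_linear curl_linear IHn !lincombE; ring.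
Qed.

Lemma defect_linear n : linear (@defect n).
Proof.
elim: n => [|n IHn] a g h; apply/funext => e; rewrite lincombE /=.
  by rewrite mulr0 addr0.
by rewrite rise_linear curl_linear IHn last_curl_linear !lincombE; ring.
Qed.

Lemma balanced_last_curl n (h : edge (laakso n) -> R) :
  balanced h -> last_curl h = 0.
Proof.
elim: n h => [//|n IHn] h [/= h0 hb]; apply/funext => e /=.
by rewrite h0 IHn//= !mulr0 addr0 mul0r.
Qed.

Lemma balanced_defect n (h : edge (laakso n) -> R) :
  balanced h -> defect h = 0.
Proof.
elim: n h => [//|n IHn] h [/= h0 hb]; apply/funext => e /=.
by rewrite h0 IHn// balanced_last_curl//= !mulr0 !addr0 mul0r.
Qed.

(** Since [flow] has sum 4 and is orthogonal to [circ] and to [2^-1 - circ ^+ 2], [rise] carries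
    [defect h] to [defect (rise h)]. Since [circ] has square sum 4 and is orthogonal to the other
    two terms, [defect h] has the same [curl] as [h]. *)
Lemma balanced_sub_defect n (h : edge (laakso n) -> R) :
  balanced (h - defect h).
Proof.
elim: n h => [//|n IHn] h.
have riseB : rise (h - @defect n.+1 h) = rise h - defect (rise h).
  apply/funext => e; rewrite riseE !subfunE /= riseE.
  by rewrite /circ /=; field.
split; last by rewrite riseB.
apply/funext => e; rewrite -[RHS]/(0 : R) curlE !subfunE /= curlE.
by rewrite /circ /=; field.
Qed.

(* The term [s * last_curl h e] is what makes the induction go through: adding a
   level changes the weight of the newest 4-cycle. *)
Lemma defect_le n (h : edge (laakso n) -> R) (M s : R) :
  (forall e, `|h e| <= M) -> - 2^-1 <= s ->
  forall e, `|defect h e + s * last_curl h e| <= ((n%:R + 1) / 2 + s) * M.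
Proof.
elim: n h s => [|n IHn] h s hM s_ge e.
  have := hM e; rewrite ler_norml => /andP[? ?].
  by rewrite /= mulr0 addr0 normr0 mulr_ge0//; lra.
case: e => e i; pose h' f := rise h f / 4.
have h'M : forall f, `|h' f| <= M by exact: rise_le.
have h'E : rise h = 4 *: h' + 0.
  by apply/funext => f; rewrite lincombE addr0 mulrC divfK.
have D0 : last_curl (0 : edge (laakso n) -> R) = 0.
  have := last_curl_linear 1 0 (0 : edge (laakso n) -> R).
  by rewrite !scale1r addr0 -[LHS]addr0 => /addrI.
have T0 : defect (0 : edge (laakso n) -> R) = 0.
  have := defect_linear 1 0 (0 : edge (laakso n) -> R).
  by rewrite !scale1r addr0 -[LHS]addr0 => /addrI.
(* On the end edges the old [last_curl] gets coefficient 1/2 + s ([Ho]). On the cycle edges it gets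
   -1/2 ([Hm]), and the new cycle has weight 1 + s ([Hx]). *)
have Ho : `|defect h' e + (2^-1 + s) * last_curl h' e|
    <= ((n%:R + 1) / 2 + (2^-1 + s)) * M by apply: IHn => //; lra.
have Hm := IHn h' _ h'M (lexx (- 2^-1)) e.
have Hx : `|(1 + s) * (curl h e / 4)| <= (1 + s) * M.
  by rewrite normrM ger0_norm ?ler_wpM2l ?curl_le//; lra.
rewrite /= h'E last_curl_linear defect_linear !lincombE D0 T0.
rewrite -[(0 : edge (laakso n) -> R) e]/(0 : R) -[n.+1%:R]natr1.
move: Ho Hm Hx; rewrite !ler_norml => /andP[? ?] /andP[? ?] /andP[? ?].
apply/andP; elim/ord6_ind: i; rewrite /circ /=; split; lra.
Qed.

(** * Test functions and the lower bound *)

(** The symmetric unit flow through [L_n], divided by the distance 4^n between bottom and top. *)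
Fixpoint mass n : edge (laakso n) -> R :=
  match n return edge (laakso n) -> R with
  | 0 => fun=> 1
  | m.+1 => fun ei => @mass m ei.1 * flow ei.2 / 4
  end.

(** For a cycle edge [i], this is minus the circulation signed by [i], reset to 0 at [i]; the value
    -1/4 on the end edges makes the rise vanish. *)
Definition test_step (i j : 'I_6) : R :=
  circ i ^+ 2 * ((i == j)%:R - circ i * circ j - (1 - circ j ^+ 2) / 4).

Fixpoint test n : edge (laakso n) -> edge (laakso n) -> R :=
  match n return edge (laakso n) -> edge (laakso n) -> R with
  | 0 => fun _ _ => 0
  | m.+1 => fun ei fj =>
      if fj.1 == ei.1 then test_step ei.2 fj.2 else @test m ei.1 fj.1
  end.

Lemma balanced0 n : balanced (0 : edge (laakso n) -> R).
Proof.
elim: n => [//|n IHn]; split; first exact: (linear0 (@curl _)).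
by rewrite (linear0 (@rise _)).
Qed.

Lemma mass_ge0 n (e : edge (laakso n)) : 0 <= mass e.
Proof.
elim: n e => [|n IHn] /=; first by [].
case=> e i /=; rewrite divr_ge0// mulr_ge0//.
by elim/ord6_ind: i; rewrite /flow /=; lra.
Qed.

Lemma sum_edgeS n (F : edge (laakso n.+1) -> R) :
  \sum_ei F ei = \sum_e \sum_i F (e, i).
Proof. by rewrite pair_bigA; apply: eq_bigr => -[]. Qed.

Lemma sum_mass n : \sum_(e : edge (laakso n)) mass e = 1.
Proof.
elim: n => [|n IHn]; first by rewrite (big_pred1 tt) //; case.
rewrite sum_edgeS -[RHS]IHn.
by apply: eq_bigr => e _; rewrite sum_ord6 /= /flow /=; field.
Qed.

(** The refinement of [test e] thus vanishes on the copy replacing [e], which leaves room there for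
    [test_step]. *)
Lemma test_diag n (e : edge (laakso n)) : test e e = 0.
Proof.
case: n e => [//|n] [e i] /=; rewrite eqxx /test_step eqxx.
by elim/ord6_ind: i; rewrite /circ /=; field.
Qed.

Lemma test_le n (e f : edge (laakso n)) : `|test e f| <= 1.
Proof.
elim: n e f => [|n IHn] /=; first by move=> _ _; rewrite normr0.
case=> e i [f j] /=; case: ifP => // _; rewrite /test_step ler_norml.
by apply/andP; elim/ord6_ind: i; elim/ord6_ind: j; rewrite /circ /=; split; lra.
Qed.

Lemma test_trace n
    (Q : {linear (edge (laakso n) -> R) -> (edge (laakso n) -> R)}) :
  (forall h, balanced (Q h)) -> (forall h, balanced h -> Q h = h) ->
  \sum_e mass e * Q (test e) e = 3 * n%:R / 8.
Proof.
elim: n Q => [|n IHn] Q Qbal Qid.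
  by rewrite big1 ?mulr0 ?mul0r// => e _; rewrite (linear0 Q) mulr0.
pose Q' : {linear (edge (laakso n) -> R) -> (edge (laakso n) -> R)} :=
  @rise _ \o Q \o @spread _.
have IHQ : \sum_e mass e * Q' (test e) e = 3 * n%:R / 8.
  apply: IHn => h; first by have [] := Qbal (spread h).
  move=> hb; rewrite /Q' /= Qid ?rise_spread//.
  by split; rewrite ?curl_spread// rise_spread.
rewrite sum_edgeS.
have -> : 3 * n.+1%:R / 8 =
    3 * n%:R / 8 + \sum_(e : edge (laakso n)) mass e * (3 / 8) :> R.
  by rewrite -mulr_suml sum_mass -[n.+1%:R]natr1; field.
rewrite -IHQ -big_split /=; apply: eq_bigr => e _.
(* [test (e, i)] is the refined old test function, plus a multiple of the newest
   4-cycle [loop], whose image under [Q] has no circulation, plus a balanced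
   function [bump i], which [Q] fixes. *)
pose loop : edge (laakso n.+1) -> R := fun fj => (fj.1 == e)%:R * circ fj.2.
pose bump i : edge (laakso n.+1) -> R := fun fj => (fj.1 == e)%:R *
  (circ i ^+ 2 * ((i == fj.2)%:R - circ i * circ fj.2 / 4 - (1 - circ fj.2 ^+ 2) / 4)).
have bumpb i : balanced (bump i).
  have r0 : rise (bump i) = 0.
    apply/funext => f; rewrite riseE /bump /=.
    by elim/ord6_ind: i; rewrite /circ /= -[RHS]/(0 : R); field.
  split; last by rewrite r0; exact: balanced0.
  apply/funext => f; rewrite curlE /bump /=.
  by elim/ord6_ind: i {r0}; rewrite /circ /= -[RHS]/(0 : R); field.
have testE i : @test n.+1 (e, i) =
    4 *: spread (test e) + (- (3 / 4) * circ i *: loop + bump i).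
  apply/funext => -[f j]; rewrite !lincombE /spread /loop /bump /=.
  case: eqP => [->|_]; last by rewrite /=; field.
  by rewrite test_diag /test_step; elim/ord6_ind: i; rewrite /circ /=; field.
have QE i : Q (@test n.+1 (e, i)) (e, i) =
    4 * Q (spread (test e)) (e, i) + (- (3 / 4) * circ i * Q loop (e, i) + bump i (e, i)).
  by rewrite testE !linearP (Qid _ (bumpb i)) !lincombE.
(* With weights [flow i / 4], the [spread] terms sum to [Q' (test e) e], the [loop] terms to a
   multiple of the zero curl of [Q loop], and the four diagonal values 3/4 of [bump], each of weight
   1/8, to 3/8. *)
have := Qbal loop => -[/(congr1 (fun g => g e))].
rewrite curlE -[X in _ = X -> _]/(0 : R) => c0 _.
rewrite riseE sum_ord6 !QE /bump /= !eqxx /circ /flow /=.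
move: c0; set a1 := Q loop _; set a2 := Q loop _; set a3 := Q loop _; set a4 := Q loop _.
move=> c0; have -> : a1 = a3 + a4 - a2 by lra.
by field.
Qed.

Lemma balanced_projection_ge n
    (Q : {linear (edge (laakso n) -> R) -> (edge (laakso n) -> R)}) (C : R) :
  (forall h, balanced (Q h)) -> (forall h, balanced h -> Q h = h) ->
  (forall h, (forall e, `|h e| <= 1) -> forall e, `|Q h e| <= C) ->
  3 * n%:R / 8 <= C.
Proof.
move=> Qbal Qid QC; rewrite -(test_trace Qbal Qid) -[C]mul1r -(sum_mass n) mulr_suml.
apply: ler_sum => e _; apply: ler_wpM2l; first exact: mass_ge0.
by apply: le_trans (ler_norm _) _; apply: QC; exact: test_le.
Qed.

Lemma balanced_projection n :
  exists Q : {linear (edge (laakso n) -> R) -> (edge (laakso n) -> R)},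
  [/\ forall h, balanced (Q h), forall h, balanced h -> Q h = h &
      forall h (M : R), (forall e, `|h e| <= M) ->
        forall e, `|Q h e| <= (n%:R + 3) / 2 * M].
Proof.
pose q (h : edge (laakso n) -> R) := h - defect h.
have q_linear : linear q.
  move=> a g h; apply/funext => e.
  by rewrite /q lincombE !subfunE defect_linear !lincombE; ring.
exists (HB.pack_for {linear (edge (laakso n) -> R) -> (edge (laakso n) -> R)}
  q (GRing.isLinear.Build _ _ _ _ q q_linear)); split => /=.
- exact: balanced_sub_defect.
- by move=> h hb; rewrite /q balanced_defect// subr0.
- move=> h M hM e; rewrite /q subfunE; apply: le_trans (ler_normB _ _) _.
  (* With s = 0 the defect costs (n+1)/2, and the identity adds 1. *)
  have := @defect_le n h M 0 hM _ e; rewrite mul0r addr0 => /(_ _)/wrap[]; first lra.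
  by have := hM e; lra.
Qed.
End EdgeFunctions.

(** * Lipschitz functions as balanced edge functions *)

Section LipschitzFunctions.
Variable R : realType.

Definition grad (G : graph) (F : vert G -> R) (e : edge G) : R :=
  F (ends e).1 - F (ends e).2.

Lemma grad_lincomb (G : graph) (a : R) (F H : vert G -> R) :
  grad (a *: F + H) = a *: grad F + grad H.
Proof. by apply/funext => e; rewrite lincombE /grad !lincombE; ring. Qed.

(** The flow is conserved at the inner vertices, so their values cancel. *)
Lemma rise_grad (G : graph) (F : vert (replace_edges G) -> R) :
  rise (grad F) = grad (F \o inl).
Proof. by apply/funext => e; rewrite riseE /grad /=; field. Qed.

Lemma curl_grad (G : graph) (F : vert (replace_edges G) -> R) :
  curl (grad F) = 0.
Proof. by apply/funext => e; rewrite -[RHS]/(0 : R) curlE /grad /=; ring. Qed.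

Lemma balanced_grad n (F : vert (laakso n) -> R) : balanced (grad F).
Proof.
elim: n F => [//|n IHn] F; split; first exact: curl_grad.
by rewrite rise_grad; exact: IHn.
Qed.

Lemma balanced_potential n (h : edge (laakso n) -> R) :
  balanced h -> exists F, grad F = h.
Proof.
elim: n h => [|n IHn] h.
  move=> _; exists (fun b : bool => if b then 0 else h tt).
  by apply/funext => -[]; rewrite /grad /= subr0.
case=> h0 /IHn[F FE].
(* Inside a copy, [h] is summed upwards from the bottom. Zero curl makes both routes to [Iv] agree,
   and then the rise fixes the last edge. *)
pose F' (w : vert (laakso n.+1)) : R := match w with
  | inl x => F x
  | inr (e, i) => F (ends e).1 - h (e, ord6 0) - match i with
    | Iu => 0 | Ip => h (e, ord6 1) | Iq => h (e, ord6 3)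
    | Iv => h (e, ord6 1) + h (e, ord6 2)
    end
  end.
exists F'; apply/funext => -[e i].
have := congr1 (fun g => g e) FE; have := congr1 (fun g => g e) h0.
rewrite curlE riseE -[X in _ = X -> _]/(0 : R) /grad.
by elim/ord6_ind: i => /=; lra.
Qed.

Section GraphSpace.
Variables (G : graph) (O : graph_space R G).
Hypothesis G_conn : forall x y : vert G, connect (@adj G) x y.

Lemma grad_le (F : graph_space R G -> R) (M : R) :
  0 <= M -> klipschitz M F -> forall e, `|grad (F : vert G -> R) e| <= M.
Proof.
move=> M0 FM e; apply: le_trans (FM (ends e).1 (ends e).2) _.
rewrite ler_piMr// -[mdist _ _]/((@gdist G (ends e).1 (ends e).2)%:R : R).
rewrite -[leRHS]/(1%:R) ler_nat.
apply: gdist_le; apply/walkP; exists [:: (ends e).2]; split=> //=.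
by rewrite andbT; apply/existsP; exists e; rewrite -surjective_pairing eqxx.
Qed.

(** Differences telescope along a shortest walk. *)
Lemma klipschitz_grad (F : graph_space R G -> R) (M : R) :
  (forall e, `|grad (F : vert G -> R) e| <= M) -> klipschitz M F.
Proof.
move=> FM x y; rewrite -[mdist _ _]/((@gdist G x y)%:R : R).
have : walk (@gdist G x y) x y by apply: walk_gdist; rewrite -gdist_lt.
move=> /walkP[p [<- + <-]] {y}; elim: p x => [|z p IHp] x /=.
  by rewrite subrr normr0 mulr0.
move=> /andP[/existsP[e xz] pz].
have -> : F x - F (last z p) = (F x - F z) + (F z - F (last z p)) by ring.
rewrite -natr1 mulrDr mulr1 addrC; apply: le_trans (ler_normD _ _) _.
apply: lerD; first exact: IHp.
have := FM e; rewrite /grad.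
by case/orP: xz => /eqP -> //=; rewrite distrC.
Qed.

Definition lip_grad (f : Lip0 O) : edge G -> R := grad (f : vert G -> R).

Lemma lip_grad_linear : linear lip_grad.
Proof. by move=> a f g; rewrite -grad_lincomb. Qed.

HB.instance Definition _ := GRing.isLinear.Build R _ _ _ lip_grad lip_grad_linear.

Lemma lip_grad_le (f : Lip0 O) e : `|lip_grad f e| <= `|f|.
Proof. by apply: grad_le; [exact: lip_const_ge0|exact: lip_constP]. Qed.

Lemma lip_norm_le (f : Lip0 O) (M : R) :
  0 <= M -> (forall e, `|lip_grad f e| <= M) -> `|f| <= M.
Proof. by move=> M0 fM; apply: lip_const_le => //; exact: klipschitz_grad. Qed.

Lemma lip_grad_inj : injective lip_grad.
Proof.
move=> f g fg; apply/eqP; rewrite -subr_eq0 -normr_le0; apply: lip_norm_le => // e.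
by rewrite linearB /= fg subrr normr0.
Qed.

Lemma lip_grad_of (F : vert G -> R) : exists f : Lip0 O, lip_grad f = grad F.
Proof.
pose f (x : graph_space R G) : R := F x - F O.
have fE : grad (f : vert G -> R) = grad F.
  by apply/funext => e; rewrite /grad /f; ring.
have fP : f \in @lip0_pred R _ O.
  apply/asboolP; split; first by rewrite /f subrr.
  exists (\sum_e `|grad F e|); apply: klipschitz_grad => e.
  by rewrite fE (bigD1 e)//= lerDl sumr_ge0.
by exists (MkLip0 fP); rewrite -fE.
Qed.

End GraphSpace.
End LipschitzFunctions.

(** * The sup norm on edge functions *)

Section SupNorm.
Variables (R : realType) (E : finType).
Implicit Types h : E -> R.

Definition sup_norm h : R := \big[Num.max/0]_e `|h e|.

Lemma sup_norm_ub h e : `|h e| <= sup_norm h.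
Proof. exact: le_bigmax. Qed.

Lemma sup_norm_le h (M : R) : 0 <= M -> (forall e, `|h e| <= M) -> sup_norm h <= M.
Proof. by move=> M0 hM; apply: bigmax_le. Qed.

Lemma sup_norm_ge0 h : 0 <= sup_norm h.
Proof. exact: bigmax_ge_id. Qed.

Lemma sup_normD g h : sup_norm (g + h) <= sup_norm g + sup_norm h.
Proof.
apply: sup_norm_le => [|e]; first by rewrite addr_ge0 ?sup_norm_ge0.
by apply: le_trans (ler_normD _ _) _; rewrite lerD ?sup_norm_ub.
Qed.

Lemma sup_normZ (a : R) h : 0 <= a -> sup_norm (a *: h) = a * sup_norm h.
Proof.
have le b g : 0 <= b -> sup_norm (b *: g) <= b * sup_norm g.
  move=> b0; apply: sup_norm_le => [|e]; first by rewrite mulr_ge0 ?sup_norm_ge0.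
  by rewrite normrM ger0_norm// ler_wpM2l ?sup_norm_ub.
move=> a0; apply/eqP; rewrite eq_le le//=; have [->|an0] := eqVneq a 0.
  by rewrite mul0r sup_norm_ge0.
have {a0}a0 : 0 < a by rewrite lt_def an0.
by rewrite -ler_pdivlMl// -{1}[h](scalerK an0) le// invr_ge0 ltW.
Qed.

End SupNorm.

(** * Projections in l_infty *)

Section OperatorNorm.
Variables (R : realType) (V W : normedModType R) (T : {linear V -> W}).

Lemma op_norm_ub x : continuous T -> `|x| <= 1 -> `|T x| <= op_norm T.
Proof.
move=> /linear_bounded_continuous/bounded_funP/(_ 1)[M TM] x1.
by apply: ub_le_sup; [exists M => _ [y y1 <-]; exact: TM|exists x].
Qed.

Lemma op_norm_le (M : R) :
  0 <= M -> (forall x, `|T x| <= M * `|x|) -> op_norm T <= M.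
Proof.
move=> M0 TM; apply: ge_sup; first by exists `|T 0|, 0; rewrite //= normr0.
by move=> _ [x /= x1 <-]; apply: le_trans (TM x) _; rewrite ler_piMr.
Qed.

Lemma linear_le_continuous (M : R) :
  (forall x, `|T x| <= M * `|x|) -> continuous T.
Proof.
move=> TM; apply/linear_bounded_continuous/bounded_funP => r.
exists (`|M| * r) => x xr; apply: le_trans (TM x) _.
apply: le_trans (ler_wpM2r _ (ler_norm M)) _ => //.
by rewrite ler_wpM2l.
Qed.

End OperatorNorm.

Section Projections.
Variables (R : realType) (n : nat) (O : laakso_space R n).
Variable J : {linear Lip0 O -> ell_infty R}.
Hypothesis J_norm : forall x, `|J x| = `|x|.

Let E := edge (laakso n).
Let gradO : {linear Lip0 O -> (E -> R)} := @lip_grad R (laakso n) O.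
Let conn := @laakso_connected n.

Let J_inj : injective J.
Proof.
by move=> x y xy; apply/eqP; rewrite -subr_eq0 -normr_eq0 -J_norm linearB /= xy subrr normr0.
Qed.

Let balanced_gradO (h : E -> R) : balanced h -> exists f, gradO f = h.
Proof.
move=> /balanced_potential[F FE].
by have [f fE] := lip_grad_of O conn F; exists f; rewrite -FE -fE.
Qed.

(** Hahn-Banach extends the coordinates of [J] to a contraction [T] on edge functions with
    [T (gradO x) = J x]. Pulling [P \o T] back through [J] and applying [gradO] projects onto the
    balanced functions, with norm at most that of [P]. *)
Lemma projection_constant_ge (P : {linear ell_infty R -> ell_infty R}) :
  projection_onto (range J) P -> 3 * n%:R / 8 <= op_norm P.
Proof.
move=> [Pcont PP Prange].
have ext m : exists f : {scalar (E -> R)},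
    (forall x, f (gradO x) = J x m) /\ forall h, f h <= sup_norm h.
  pose g (x : Lip0 O) : R := J x m.
  have g_scalar : scalar g by move=> a x y; rewrite /g linearP.
  pose gS : {scalar Lip0 O} := HB.pack g (GRing.isLinear.Build _ _ _ _ g g_scalar).
  apply: (@hahn_banach R (E -> R) (@sup_norm R E) _ _ (Lip0 O) gradO gS).
  - exact: sup_normD.
  - by move=> a h; exact: sup_normZ.
  move=> x; apply: le_trans (ler_norm _) _; apply: le_trans (ell_norm_ub (J x) m) _.
  rewrite -[leLHS]/(`|J x|) J_norm; apply: lip_norm_le => //.
    exact: sup_norm_ge0.
  exact: sup_norm_ub.
have [f fP] := choice ext.
have f_le m h : `|f m h| <= sup_norm h.
  apply: (@scalar_norm_le _ _ (f m) (@sup_norm R E)) => {}h; last exact: (fP m).2.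
  by apply: eq_bigr => e _; rewrite normrN.
have Tb h : (fun m => f m h) \in @bounded_seq R.
  by apply/bounded_seqP; exists (sup_norm h) => m; exact: f_le.
pose T h : ell_infty R := EllInfty (Tb h).
have Tlin a g h : T (a *: g + h) = a *: T g + T h.
  by apply: val_inj; apply/funext => m; rewrite /= linearP.
have TJ x : T (gradO x) = J x.
  by apply: val_inj; apply/funext => m; rewrite /= (fP m).1.
have lift h : exists x, J x = P (T h).
  by have [x _ xE] : range J (P (T h)); [rewrite -Prange; exists (T h)|exists x].
have [r rP] := choice lift.
have r_grad x : r (gradO x) = x.
  apply: J_inj; rewrite rP TJ.
  have [u _ <-] : range P (J x) by rewrite Prange; exists x.
  exact: PP.
pose q h := gradO (r h).
have q_linear : linear q.
  move=> a g h; rewrite /q -linearP; congr (gradO _); apply: J_inj.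
  by rewrite linearP !rP Tlin linearP.
pose Q : {linear (E -> R) -> (E -> R)} :=
  HB.pack q (GRing.isLinear.Build _ _ _ _ q q_linear).
apply: (@balanced_projection_ge R n Q) => /=.
- by move=> h; exact: balanced_grad.
- by move=> h /balanced_gradO[x <-]; rewrite /q r_grad.
move=> h h1 e; apply: le_trans (lip_grad_le _ _) _; rewrite -J_norm rP.
apply: op_norm_ub => //; apply: ell_norm_le => m; apply: le_trans (f_le m h) _.
exact: sup_norm_le.
Qed.

(** Dually, the edge slopes extend from [range J] to a contraction [T] on l_infty with
    [T (J x) = gradO x]. The explicit [Q] is applied after [T], and its balanced values are carried
    back to [range J]. *)
Lemma projection_constant_le :
  exists2 P, projection_onto (range J) P & op_norm P <= (n%:R + 3) / 2.
Proof.
have ext (e : E) : exists f : {scalar ell_infty R},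
    (forall x, f (J x) = gradO x e) /\ forall u, f u <= `|u|.
  pose g (x : Lip0 O) : R := gradO x e.
  have g_scalar : scalar g by move=> a x y; rewrite /g linearP.
  pose gS : {scalar Lip0 O} := HB.pack g (GRing.isLinear.Build _ _ _ _ g g_scalar).
  apply: (@hahn_banach R (ell_infty R) (fun u => `|u|) _ _ (Lip0 O) J gS).
  - exact: ler_normD.
  - by move=> a u a0; rewrite normrZ ger0_norm.
  by move=> x; apply: le_trans (ler_norm _) _; rewrite J_norm; exact: lip_grad_le.
have [f fP] := choice ext.
have f_le e u : `|f e u| <= `|u|.
  apply: (@scalar_norm_le _ _ (f e) (fun u => `|u|)) => {}u; last exact: (fP e).2.
  by rewrite normrN.
pose T u : E -> R := fun e => f e u.
have Tlin a u v : T (a *: u + v) = a *: T u + T v.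
  by apply/funext => e; rewrite /T linearP.
have TJ x : T (J x) = gradO x.
  by apply/funext => e; rewrite /T (fP e).1.
have [Q [Qbal Qid Qle]] := balanced_projection R n.
have [r rP] := choice (fun u => balanced_gradO (Qbal (T u))).
have r_J x : r (J x) = x.
  by apply: (lip_grad_inj conn); rewrite rP TJ Qid//; exact: balanced_grad.
pose p u := J (r u).
have p_linear : linear p.
  move=> a u v; rewrite /p -linearP; congr (J _); apply: (lip_grad_inj conn).
  by rewrite linearP !rP Tlin linearP.
pose P : {linear ell_infty R -> ell_infty R} :=
  HB.pack p (GRing.isLinear.Build _ _ _ _ p p_linear).
have c0 : 0 <= (n%:R + 3) / 2 :> R by rewrite divr_ge0 ?addr_ge0.
have Ple u : `|P u| <= (n%:R + 3) / 2 * `|u|.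
  rewrite /= J_norm; apply: (lip_norm_le conn) => [|e]; first by rewrite mulr_ge0.
  by rewrite rP; apply: Qle => {}e; exact: f_le.
exists P; last exact: op_norm_le.
split; first exact: linear_le_continuous Ple.
- by move=> u /=; rewrite /p r_J.
- apply/seteqP; split=> [_ [u _ <-]|_ [x _ <-]]; first by exists (r u).
  by exists (J x) => //=; rewrite /p r_J.
Qed.

End Projections.

Local Close Scope classical_set_scope.

Theorem theorem16 (R : realType) (n : nat) (O : laakso_space R n)
    (X1 : set (ell_infty R)) :
  (1 <= n)%N ->
  isometric_copy (Lip0 O) X1 ->
  (((3 * n%:R - 5) / 8)%:E <= projection_constant X1 <= ((n%:R + 3) / 2)%:E)%E.
Proof.
move=> _ [J [J_norm <-]]; apply/andP; split.
  apply: le_ereal_inf_tmp => _ [P PP <-]; rewrite lee_fin.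
  (* The bound obtained is 3n/8, above the claimed (3n-5)/8. *)
  by apply: le_trans (projection_constant_ge J_norm PP); lra.
have [P PP P_le] := projection_constant_le J_norm.
apply: (@le_trans _ _ (op_norm P)%:E); last by rewrite lee_fin.
by apply: ereal_inf_lbound; exists P.
Qed.
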